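(* Let $G$ be a group, let $\operatorname{Conj} G=(G,s)$ be its conjugation quandle, and let $X\subseteq G$ be such that $\operatorname{Conj} X=(X,s|_X)$ is a subquandle of $\operatorname{Conj} G$. Let $Z(\langle X\rangle)$ be the center of the subgroup $\langle X\rangle\leq G$ generated by $X$. Then for all functions $\rho:X\to X$, $\rho$ is a good involution of $\operatorname{Conj} X$ if and only if there exists a function $\zeta:X\to Z(\langle X\rangle)$ such that \[ \rho(x)=(\zeta(x)x)^{-1},\qquad \zeta s_x=\zeta=\zeta\rho \] for all $x\in X$ (juxtaposition of functions denotes composition, and $s_x$ is regarded as a permutation of $X$, so the second condition says $\zeta(xyx^{-1})=\zeta(y)=\zeta(\rho(y))$ for all $x,y\in X$).
   Context: A rack is a pair $R=(X,s)$ where $X$ is a nonempty set and $s:X\to S_X$, $x\mapsto s_x$, is a map to the symmetric group of $X$ with $s_xs_y=s_{s_x(y)}s_x$ for all $x,y\in X$. A quandle is a rack with $s_x(x)=x$ for all $x$. A subset $Y\subseteq X$ of a quandle $(X,s)$ gives a subquandle $(Y,s|_Y)$ if $s_y(Y)=Y$ for all $y\in Y$. For a group $G$, $\operatorname{Conj} G=(G,s)$ is the quandle with $s_g(h)=ghg^{-1}$. A good involution of a rack $(X,s)$ is a map $\rho:X\to X$ with $\rho^2=\mathrm{id}_X$ (the identity is allowed) such that $\rho s_x=s_x\rho$ and $s_{\rho(x)}=s_x^{-1}$ for all $x\in X$. *)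

(* Defs.v *)
From mathcomp Require Import all_boot.
From mathcomp Require Import monoid.
From mathcomp Require Import boolp classical_sets.

Set Implicit Arguments.
Unset Strict Implicit.
Unset Printing Implicit Defensive.

Local Open Scope classical_set_scope.
Local Open Scope group_scope.

(* The symmetric group S_X of a possibly infinite type X. Permutations are
   compared through the functions underlying them, with =1. *)
Record sym (X : Type) := Sym {
  sym_fun :> X -> X;
  sym_invfun : X -> X;
  sym_funK : cancel sym_fun sym_invfun;
  sym_invfunK : cancel sym_invfun sym_fun }.

Definition sym_inv (X : Type) (f : sym X) : sym X :=
  Sym (@sym_invfunK X f) (@sym_funK X f).

Record rack := Rack {
  rack_sort :> Type;
  rack_nonempty : inhabited rack_sort;
  rack_s : rack_sort -> sym rack_sort;
  rack_sP : forall x y,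
    rack_s x \o rack_s y =1 rack_s (rack_s x y) \o rack_s x }.

Record quandle := Quandle {
  quandle_rack :> rack;
  quandle_sP : forall x : quandle_rack, rack_s x x = x }.

Definition good_involution (R : rack) (rho : R -> R) : Prop :=
  [/\ rho \o rho =1 id,
      forall x : R, rho \o rack_s x =1 rack_s x \o rho
    & forall x : R, rack_s (rho x) =1 sym_inv (rack_s x)].

(* Nonemptiness is part of being a rack. *)
Definition is_subquandle (Q : quandle) (Y : set Q) : Prop :=
  Y !=set0 /\ forall y, Y y -> rack_s y @` Y = Y.

Section Subquandle.
Variables (Q : quandle) (Y : set Q) (hY : is_subquandle Y).

Lemma sub_s_subproof (x y : Y) : rack_s (val x) (val y) \in Y.
Proof.
apply/mem_set; rewrite -[X in X _](hY.2 _ (set_valP x)).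
by exists (val y) => //; exact: set_valP.
Qed.

Lemma sub_sV_subproof (x y : Y) :
  sym_inv (rack_s (val x)) (val y) \in Y.
Proof.
apply/mem_set; have := set_valP y.
by rewrite -{1}(hY.2 _ (set_valP x)) => -[z Yz <-]; rewrite /= sym_funK.
Qed.

Definition sub_s_fun (x y : Y) : Y := SigSub (sub_s_subproof x y).
Definition sub_s_invfun (x y : Y) : Y := SigSub (sub_sV_subproof x y).

Lemma sub_s_funK (x : Y) : cancel (sub_s_fun x) (sub_s_invfun x).
Proof. by move=> y; apply: val_inj; rewrite /= sym_funK. Qed.

Lemma sub_s_invfunK (x : Y) : cancel (sub_s_invfun x) (sub_s_fun x).
Proof. by move=> y; apply: val_inj; rewrite /= sym_invfunK. Qed.

Definition sub_s (x : Y) : sym Y := Sym (@sub_s_funK x) (@sub_s_invfunK x).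

Lemma sub_nonempty : inhabited Y.
Proof. by have [y Yy] := hY.1; exact: (inhabits (SigSub (mem_set Yy))). Qed.

Lemma sub_sP (x y : Y) : sub_s x \o sub_s y =1 sub_s (sub_s x y) \o sub_s x.
Proof. by move=> z; apply: val_inj; exact: rack_sP. Qed.

Lemma sub_quandleP (x : Y) : sub_s x x = x.
Proof. by apply: val_inj; exact: quandle_sP. Qed.

Definition subquandle : quandle :=
  @Quandle (Rack sub_nonempty sub_sP) sub_quandleP.

End Subquandle.

Section Conj.
Variable G : groupType.

Lemma conj_funK (g : G) :
  cancel (fun h => g * h * g^-1) (fun h => g^-1 * h * g).
Proof. by move=> h; rewrite !mulgA mulVg mul1g mulgVK. Qed.

Lemma conj_invfunK (g : G) :
  cancel (fun h => g^-1 * h * g) (fun h => g * h * g^-1).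
Proof. by move=> h; rewrite !mulgA mulgV mul1g mulgK. Qed.

Definition conj_s (g : G) : sym G := Sym (conj_funK g) (conj_invfunK g).

Lemma conj_sP (g h : G) :
  conj_s g \o conj_s h =1 conj_s (conj_s g h) \o conj_s g.
Proof. by move=> k; rewrite /= !invgM invgK !mulgA !mulgVK. Qed.

Lemma conj_quandleP (g : G) : conj_s g g = g.
Proof. by rewrite /= mulgK. Qed.

Definition Conj : quandle :=
  @Quandle (Rack (inhabits (1 : G)) conj_sP) conj_quandleP.

End Conj.

Definition is_subgroup (G : groupType) (H : set G) : Prop :=
  [/\ H 1, forall x y, H x -> H y -> H (x * y) & forall x, H x -> H x^-1].

Definition generated (G : groupType) (X : set G) : set G :=
  smallest (@is_subgroup G) X.

Definition center (G : groupType) (H : set G) : set G :=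
  [set z | H z /\ forall h, H h -> commute z h].

(* Main.v *)
(* The condition s_(rho x) = s_x^-1 says exactly that x * rho x centralises X,
   so zeta x = (x * rho x)^-1 lies in the center of <X>; the other two
   conditions on zeta then express that rho commutes with each s_x and is an
   involution. *)
Require Import Defs.
From mathcomp Require Import all_boot.
From mathcomp Require Import monoid.
From mathcomp Require Import boolp classical_sets.

Local Open Scope classical_set_scope.
Local Open Scope group_scope.

Section Generated.
Variables (G : groupType) (X : set G).

Lemma generated_is_subgroup : is_subgroup (generated X).
Proof.
split=> [H [] [] //|x y gx gy H HP|x gx H HP].
  by have [[_ HM _] _] := HP; apply: HM; [exact: gx | exact: gy].
by have [[_ _ HV] _] := HP; apply: HV; exact: gx.
Qed.

Lemma sub_generated : X `<=` generated X.
Proof. exact: sub_smallest. Qed.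

Lemma centralizer_is_subgroup (z : G) : is_subgroup (commute z).
Proof.
by split=> [|x y|x]; [exact: commute1 | exact: commuteM | exact: commuteV].
Qed.

(** The centralizer of [z] is a subgroup containing [X], hence it contains [generated X] by
    minimality. *)
Lemma center_generated (z : G) :
  generated X z -> X `<=` commute z -> center (generated X) z.
Proof.
move=> gz zX; split=> // h; apply: smallest_sub zX h.
exact: centralizer_is_subgroup.
Qed.

End Generated.

Theorem theorem1p3 (G : groupType) (X : set G)
    (hX : @is_subquandle (Conj G) X) (rho : X -> X) :
  @good_involution (@subquandle (Conj G) X hX) rho <->
  exists zeta : X -> center (generated X),
    forall x : X,
      [/\ val (rho x) = (val (zeta x) * val x)^-1,
          zeta \o @rack_s (@subquandle (Conj G) X hX) x =1 zeta
        & zeta =1 zeta \o rho].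
Proof.
have gX (x : X) : generated X (val x) := sub_generated _ _ _ (set_valP x).
split=> [[rhoK rho_s s_rho]|[zeta zetaP]].
- have [_ gM gV] := generated_is_subgroup _ X.
  have comm_rho (x y : X) : commute (val x * val (rho x)) (val y).
    (* Evaluated at [y], [s_rho] reads [rho(x) y rho(x)^-1 = x^-1 y x]; multiply by [rho(x)] on the
       right and by [x] on the left. *)
    have /(congr1 val) /= := s_rho x y.
    move/(canRL (mulgVK _)) => rho_y.
    by rewrite /commute -mulgA rho_y !mulgA mulgV mul1g.
  have zetaP (x : X) : (val x * val (rho x))^-1 \in center (generated X).
    apply/mem_set/center_generated.
      exact: gV (gM _ _ (gX x) (gX (rho x))).
    move=> y Xy; apply/commute_sym/commuteV/commute_sym.
    exact: (comm_rho x (SigSub (mem_set Xy))).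
  exists (fun x => SigSub (zetaP x)) => x; split=> [|y|y].
  + by rewrite /= invgM invgK mulKg.
  + apply: val_inj => /=.
    (* Moving [rho] past [s_x] turns the left side into the inverse of [x (y rho(y)) x^-1], and
       [y rho(y)] commutes with [x]. *)
    have /(congr1 val) /= -> := rho_s x y.
    have cz : commute (val x) (val y * val (rho y)).
      exact/commute_sym/comm_rho.
    by rewrite !mulgA mulgVK -(mulgA (val x)) cz mulgK.
  + apply: val_inj => /=.
    have /= -> := rhoK y.
    (* [rho(y) y] is the conjugate [y^-1 (y rho(y)) y], so it equals [y rho(y)]. *)
    rewrite -[val (rho y) * val y](mulKg (val y)).
    by rewrite (mulgA _ (val (rho y))) comm_rho mulKg.
have comm_zeta (x y : X) : commute (val (zeta x)) (val y).
  by have [_] := set_valP (zeta x); exact.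
have rhoE x : val (rho x) = (val (zeta x) * val x)^-1 by have [] := zetaP x.
have zeta_s x y : zeta (rack_s (x : subquandle hX) y) = zeta y.
  by have [_ /(_ y)] := zetaP x.
have zeta_rho x : zeta (rho x) = zeta x by have [_ _ /(_ x)] := zetaP x.
split=> [x|x y|x y]; apply: val_inj => /=.
(* With [z = zeta x = zeta (rho x)]: [(z (z x)^-1)^-1 = z x z^-1 = x]. *)
- by rewrite rhoE zeta_rho rhoE invgM invgK comm_zeta mulgK.
(* As [zeta y] is unchanged by [s_x] and commutes with [x], both sides are
   [x (zeta(y) y)^-1 x^-1]. *)
- rewrite !rhoE zeta_s /= 2!(mulgA (val (zeta y))) comm_zeta.
  by rewrite !invgM invgK !mulgA.
(* Conjugation by [(zeta(x) x)^-1] is conjugation by [x^-1] on [X], since [zeta x] commutes with [y]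
   and cancels. *)
- rewrite rhoE invgK invgM !mulgA -(mulgA _ (val y)) -comm_zeta.
  by rewrite mulgA mulgVK.
Qed.
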